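(* Let $\mathfrak g$ be a finite-dimensional real Lie algebra whose derived algebra $\mathfrak g'=[\mathfrak g,\mathfrak g]$ is abelian, and suppose that for every $Y\in\mathfrak g$ the restriction $\operatorname{ad}(Y)|_{\mathfrak g'}$ is semisimple with real eigenvalues. Then $\mathfrak g$ admits an inner product with a geodesic basis, unless $\mathfrak g$ is isomorphic to $\mathcal A_n$ for some $n\ge 1$.
   Context: For an inner product $\langle\cdot,\cdot\rangle$ on a real Lie algebra $\mathfrak g$, a nonzero $X\in\mathfrak g$ is a geodesic element if $\langle X,[X,Y]\rangle=0$ for all $Y\in\mathfrak g$; a geodesic basis is a basis consisting of geodesic elements. For $n\ge1$, $\mathcal A_n$ denotes the $(n+1)$-dimensional real Lie algebra with basis $\{Y,X_1,\dots,X_n\}$ and brackets $[Y,X_i]=X_i$, $[X_i,X_j]=0$ (i.e. the abelian algebra $\mathbb R^n$ extended by one element acting as the identity map). *)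

(* Defs.v *)
(* a finite-dimensional real Lie algebra is modelled as
   'rV[R]_N (R : realType) equipped with a Lie bracket. *)
From HB Require Import structures.
From mathcomp Require Import all_boot all_order all_algebra.
From mathcomp Require Import reals.
Set Implicit Arguments. Unset Strict Implicit. Unset Printing Implicit Defensive.
Import Order.TTheory GRing.Theory Num.Theory.
Local Open Scope ring_scope.

Section LieDefs.
Variable R : realType.

Definition is_lie_bracket (N : nat) (br : 'rV[R]_N -> 'rV[R]_N -> 'rV[R]_N) : Prop :=
  [/\ (forall (a : R) x y z, br (a *: x + y) z = a *: br x z + br y z),
      (forall (a : R) x y z, br z (a *: x + y) = a *: br z x + br z y),
      (forall x, br x x = 0) &
      (forall x y z, br x (br y z) + br y (br z x) + br z (br x y) = 0)].

Definition in_derived (N : nat) (br : 'rV[R]_N -> 'rV[R]_N -> 'rV[R]_N)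
  (v : 'rV[R]_N) : Prop :=
  exists k (xs ys : 'I_k -> 'rV[R]_N), v = \sum_(i < k) br (xs i) (ys i).

Definition derived_abelian (N : nat) (br : 'rV[R]_N -> 'rV[R]_N -> 'rV[R]_N) : Prop :=
  forall u v, in_derived br u -> in_derived br v -> br u v = 0.

(* ad(Y)|_{g'} is semisimple with real eigenvalues, i.e. diagonalizable over R:
   g' is spanned by real eigenvectors of ad(Y) lying in g'. *)
Definition ad_restr_real_semisimple (N : nat)
  (br : 'rV[R]_N -> 'rV[R]_N -> 'rV[R]_N) (Y : 'rV[R]_N) : Prop :=
  forall v, in_derived br v ->
    exists k (ws : 'I_k -> 'rV[R]_N) (lams : 'I_k -> R),
      (forall i, in_derived br (ws i) /\ br Y (ws i) = lams i *: ws i) /\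
      v = \sum_(i < k) ws i.

Definition is_inner_product (N : nat) (ip : 'rV[R]_N -> 'rV[R]_N -> R) : Prop :=
  [/\ (forall (a : R) x y z, ip (a *: x + y) z = a * ip x z + ip y z),
      (forall x y, ip x y = ip y x) &
      (forall x, x != 0 -> 0 < ip x x)].

Definition geodesic_element (N : nat) (ip : 'rV[R]_N -> 'rV[R]_N -> R)
  (br : 'rV[R]_N -> 'rV[R]_N -> 'rV[R]_N) (X : 'rV[R]_N) : Prop :=
  X != 0 /\ forall Y, ip X (br X Y) = 0.

Definition has_geodesic_basis (N : nat) (ip : 'rV[R]_N -> 'rV[R]_N -> R)
  (br : 'rV[R]_N -> 'rV[R]_N -> 'rV[R]_N) : Prop :=
  exists b : 'I_N -> 'rV[R]_N,
    row_free (\matrix_(i < N) b i) /\ forall i, geodesic_element ip br (b i).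

(* The algebra A_n on 'rV_(n.+1): basis Y = e_0, X_i = e_i (1 <= i <= n),
   [Y, X_i] = X_i, [X_i, X_j] = 0. For a = aY*Y + a', b = bY*Y + b':
   [a, b] = aY *: b' - bY *: a'. *)
Definition e0 (n : nat) : 'rV[R]_(n.+1) := delta_mx 0 ord0.
Definition A_bracket (n : nat) (a b : 'rV[R]_(n.+1)) : 'rV[R]_(n.+1) :=
  a 0 ord0 *: (b - b 0 ord0 *: e0 n) - b 0 ord0 *: (a - a 0 ord0 *: e0 n).

Definition lie_isomorphic (N M : nat)
  (br1 : 'rV[R]_N -> 'rV[R]_N -> 'rV[R]_N) (br2 : 'rV[R]_M -> 'rV[R]_M -> 'rV[R]_M) : Prop :=
  exists F : 'M[R]_(N, M),
    [/\ row_free F, row_full F &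
        forall x y, br1 x y *m F = br2 (x *m F) (y *m F)].

End LieDefs.

(* Main.v *)
(** Since [g'] is abelian, the operators [ad Y] on [g'] commute, so [g'] has a
    basis [e_i] of common eigenvectors, [[Y, e_i] = lam_i(Y) e_i]. For any
    complement [p] of [g'] and any inner product with [p] orthogonal to [g'],
    every nonzero element of [p] is geodesic, so it remains to produce geodesic
    elements that span [g'] modulo [p].

    If every nonzero [lam_i] vanishes somewhere outside [g'], make the [e_i]
    orthonormal. For [x] in [ker lam_i] outside [g'] and [lam_i(Y) = 1], the
    Jacobi identity shows that the [e_i]-component of [[x, Z]] is
    [- lam_i(Z)] times that of [[Y, x]]; hence [P - c e_i] is geodesic,
    where [P] in [p] represents [x] modulo [g'] and [c] is the [e_i]-component
    of [[Y, P]], and [p] can be tilted so that each of these [c] is nonzero.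

    Otherwise [g = R Y + g']. If [ad Y] has a single eigenvalue on [g'], then
    [g] is some [A_n]. If not, give the [e_i] unit length and pairwise inner
    product [s] close to [1]: for distinct eigenvalues [p], [q] of [e_i], [e_j],
    the vector [a e_i + b e_j] is geodesic iff
    [p a^2 + s (p + q) a b + q b^2 = 0], a form of discriminant
    [s^2 (p + q)^2 - 4 p q], which tends to [(p - q)^2 > 0]; its two isotropic
    lines span [e_i] and [e_j]. *)
Require Import Defs.
From HB Require Import structures.
From mathcomp Require Import all_boot all_order all_algebra.
From mathcomp Require Import ring lra.
From mathcomp Require Import boolp reals.
Set Implicit Arguments. Unset Strict Implicit. Unset Printing Implicit Defensive.
Import Order.TTheory GRing.Theory Num.Theory.
Local Open Scope ring_scope.

(** * Bases extracted from separating sets of vectors *)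

(** Greedy extension: a nonzero column of the cokernel of a free family [A] kills every row of [A],
    so a vector of [P] that it does not kill extends [A]. This is applied to eigenvectors and to
    geodesic elements. *)
Lemma basis_of_separating (F : fieldType) (n : nat) (P : 'rV[F]_n -> Prop) :
  (forall h : 'cV[F]_n, (forall x, P x -> x *m h = 0) -> h = 0) ->
  exists b : 'I_n -> 'rV[F]_n, row_free (\matrix_i b i) /\ forall i, P (b i).
Proof.
move=> sepP.
suff /(_ n (leqnn n)) [A Afree PA] : forall k, (k <= n)%N ->
    exists2 A : 'M[F]_(k, n), row_free A & forall i, P (row i A).
  exists (fun i => row i A); split=> //.
  by congr (is_true (row_free _)): Afree; apply/row_matrixP=> i; rewrite rowK.
elim=> [|k IHk] lekn.
  by exists 0 => [|[]//]; rewrite /row_free mxrank0.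
have [A Afree PA] := IHk (ltnW lekn).
have /eqP/matrixP cokerA : cokermx A != 0.
  by rewrite cokermx_eq0 /row_full (eqP Afree) neq_ltn lekn.
have [j nzj] : exists j, col j (cokermx A) != 0.
  apply: contrapT => /forallNP all0; apply: cokerA => i j.
  by have /negP := all0 j; rewrite negbK => /eqP/matrixP/(_ i 0); rewrite !mxE.
have Ah : A *m col j (cokermx A) = 0.
  by rewrite colE mulmxA mulmx_coker mul0mx.
have [x Px nzx] : exists2 x, P x & x *m col j (cokermx A) != 0.
  apply: contrapT => noP; move/eqP: nzj; apply; apply: sepP => x Px.
  by apply: contrapT => /eqP nz; apply: noP; exists x.
have xAfree : row_free (col_mx x A).
  apply: inj_row_free => v; rewrite -[v]hsubmxK mul_row_col => v0.
  have l0 : lsubmx v = 0.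
    move/(congr1 (mulmx^~ (col j (cokermx A)))): (v0).
    rewrite /= mulmxDl -!mulmxA Ah mulmx0 addr0 mul0mx.
    rewrite [lsubmx _]mx11_scalar mul_scalar_mx => /eqP.
    by rewrite scalemx_eq0 (negPf nzx) orbF => /eqP->; rewrite raddf0.
  move: v0; rewrite l0 mul0mx add0r => /eqP; rewrite mulmx_free_eq0 // => /eqP->.
  by rewrite row_mx0.
exists (col_mx x A) => // i; case: (@split_ordP 1 k i) => i' ->.
  by rewrite (@rowKu _ 1 k n) ord1; congr P: Px; apply/rowP=> l; rewrite !mxE.
by rewrite (@rowKd _ 1 k n).
Qed.

Lemma row_diag_mul (F : fieldType) m n (d : 'rV[F]_m) (A : 'M_(m, n)) i :
  row i (diag_mx d *m A) = d 0 i *: row i A.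
Proof. by rewrite row_mul row_diag_mx -scalemxAl -rowE. Qed.

Lemma diagonalizable_eigenbasis (F : fieldType) n (A : 'M[F]_n) :
  (forall h : 'cV_n,
     (forall (w : 'rV_n) l, w *m A = l *: w -> w *m h = 0) -> h = 0) ->
  diagonalizable A.
Proof.
move=> sep.
have [|b [bfree bA]] :=
  @basis_of_separating _ n (fun w => exists l, w *m A = l *: w).
  by move=> h hk; apply: sep => w l wl; apply: hk; exists l.
have {bA}[l bA] := choice bA.
exists (\matrix_i b i); first by rewrite -row_free_unit.
apply/diagonalizable_forPex; exists (\row_i l i).
apply: simmxW => //; apply/row_matrixP=> i.
by rewrite row_mul row_diag_mul rowK bA mxE.
Qed.

(** * Adjoint matrices, the derived algebra and its weights *)

Section LieBracket.
Variables (R : realType) (N : nat) (br : 'rV[R]_N -> 'rV[R]_N -> 'rV[R]_N).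
Hypothesis brP : is_lie_bracket br.

Lemma brDr x y z : br x (y + z) = br x y + br x z.
Proof. by have [_ lr _ _] := brP; have := lr 1 y z x; rewrite !scale1r. Qed.

Lemma brDl x y z : br (x + y) z = br x z + br y z.
Proof. by have [ll _ _ _] := brP; have := ll 1 x y z; rewrite !scale1r. Qed.

Lemma br0r x : br x 0 = 0.
Proof. by apply: (addIr (br x 0)); rewrite -brDr !add0r. Qed.

Lemma brZr a x y : br x (a *: y) = a *: br x y.
Proof. by have [_ lr _ _] := brP; have := lr a y 0 x; rewrite br0r !addr0. Qed.

Lemma brC x y : br x y = - br y x.
Proof.
have [_ _ alt _] := brP; apply/eqP; rewrite -addr_eq0.
by have := alt (x + y); rewrite brDl !brDr !alt add0r addr0 => ->.
Qed.

Lemma br_sumr x (I : finType) (F : I -> 'rV[R]_N) :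
  br x (\sum_i F i) = \sum_i br x (F i).
Proof. exact: (big_morph (br x) (brDr x) (br0r x)). Qed.

Definition ad x : 'M[R]_N := \matrix_i br x (delta_mx 0 i).

Lemma mul_ad x y : y *m ad x = br x y.
Proof.
rewrite [in RHS](row_sum_delta y) br_sumr mulmx_sum_row.
by apply: eq_bigr => i _; rewrite rowK brZr.
Qed.

Lemma br_row x m (B : 'M_(m, N)) i : br x (row i B) = row i (B *m ad x).
Proof. by rewrite row_mul mul_ad. Qed.

Lemma br_suml x y : br x y = \sum_i x 0 i *: br (delta_mx 0 i) y.
Proof.
rewrite brC [in LHS](row_sum_delta x) br_sumr -sumrN.
by apply: eq_bigr => i _; rewrite brZr -scalerN -brC.
Qed.

Definition derived_mx : 'M[R]_N := (\sum_i ad (delta_mx 0 i))%MS.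

Lemma br_sub_derived x y : (br x y <= derived_mx)%MS.
Proof.
rewrite br_suml; apply: summx_sub => i _; apply: scalemx_sub; rewrite -mul_ad.
exact: submx_trans (submxMl _ _) (sumsmx_sup i _ _).
Qed.

Lemma in_derivedP v : in_derived br v <-> (v <= derived_mx)%MS.
Proof.
split=> [[k [xs [ys ->]]]|/sub_sumsmxP[u ->]].
  by apply: summx_sub => i _; apply: br_sub_derived.
exists N, (fun i => delta_mx 0 i), u.
by apply: eq_bigr => i _; rewrite mul_ad.
Qed.

Lemma br_br_derived x y b : derived_abelian br -> in_derived br b ->
  br x (br y b) = br y (br x b).
Proof.
move=> dab bd; have [_ _ _ jac] := brP; have := jac x y b.
rewrite [X in _ + X]dab //; last by apply/in_derivedP/br_sub_derived.
by rewrite addr0 (brC b x) -scaleN1r brZr scaleN1r => /eqP;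
  rewrite subr_eq0 => /eqP.
Qed.

(** Column [i] of [L] is the weight of the common eigenvector [row i B], seen as a linear
    functional; [B *m L = 0] makes the weights vanish on the span of [B]. *)
Lemma weight_basis :
  derived_abelian br -> (forall Y, ad_restr_real_semisimple br Y) ->
  exists m (B : 'M[R]_(m, N)) (L : 'M[R]_(N, m)),
  [/\ row_free B, forall x y, (br x y <= B)%MS,
      forall x i, br x (row i B) = (x *m L) 0 i *: row i B
    & B *m L = 0].
Proof.
move=> dab ssimple.
have [m [B0 [B0free eqB0]]] : exists m (B0 : 'M_(m, N)),
    row_free B0 /\ (B0 :=: derived_mx)%MS.
  exists _, (row_base derived_mx).
  by split; [apply: row_base_free | apply: eq_row_base].
have derB0 v : in_derived br v <-> (v <= B0)%MS.
  by rewrite eqB0; apply: in_derivedP.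
have brB0 x y : (br x y <= B0)%MS by rewrite eqB0 br_sub_derived.
have [Phi B0Phi] := row_freeP B0free.
have PhiB0 k (v : 'M_(k, N)) : (v <= B0)%MS -> v *m Phi *m B0 = v.
  by case/submxP=> c ->; rewrite -(mulmxA c) B0Phi mulmx1.
pose A x : 'M_m := B0 *m ad x *m Phi.
have AB0 x : A x *m B0 = B0 *m ad x.
  by apply: PhiB0; apply/row_subP=> i; rewrite -br_row.
have rB0 i : in_derived br (row i B0) by apply/derB0/row_sub.
have Acomm x y : A x *m A y = A y *m A x.
  have AA u v : A u *m A v = B0 *m ad u *m ad v *m Phi.
    by rewrite -AB0 -(mulmxA (A u) B0) -(mulmxA (A u) (B0 *m _)).
  rewrite !AA; congr (_ *m _).
  by apply/row_matrixP=> i; rewrite !row_mul !mul_ad br_br_derived.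
(* Semisimplicity writes each row of [B0] as a sum of eigenvectors of [ad x], so a functional
   killing all eigenvectors of [A x] is zero. *)
have Adiag x : diagonalizable (A x).
  apply: diagonalizable_eigenbasis => h hk; apply/row_matrixP=> i.
  rewrite row0 -[h]mul1mx row_mul.
  have /(ssimple x) [k [ws [ls [wsP]]]] := rB0 i.
  move/(congr1 (mulmx^~ Phi)); rewrite /= -row_mul B0Phi => ->.
  rewrite !mulmx_suml big1 // => j _; have [/derB0 wd we] := wsP j.
  apply: (hk _ (ls j)).
  by rewrite /A !mulmxA PhiB0 // mul_ad we scalemxAl.
(* Finitely many operators suffice: the weights at a general [x] follow by linearity. *)
have [P Punit /allP Pdiag] : codiagonalizable [seq A (delta_mx 0 k) | k : 'I_N].
  apply/codiagonalizableP; split.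
    by move=> _ _ /imageP[k _ ->] /imageP[l _ ->]; apply: Acomm.
  by move=> _ /imageP[k _ ->].
have Pfree : row_free P by rewrite row_free_unit.
have /choice[D PD] k : exists d, P *m A (delta_mx 0 k) = diag_mx d *m P.
  have /Pdiag/diagonalizable_forPex[d /(simmxP Punit)] : A (delta_mx 0 k) \in
    [seq A (delta_mx 0 k) | k : 'I_N] by apply: image_f.
  by exists d.
pose B := P *m B0; pose L : 'M_(N, m) := \matrix_k D k.
have Bfree : row_free B.
  by apply/row_freeP; exists (Phi *m invmx P);
    rewrite mulmxA -(mulmxA P) B0Phi mulmx1 mulmxV.
have brL x i : br x (row i B) = (x *m L) 0 i *: row i B.
  rewrite br_suml mxE scaler_suml; apply: eq_bigr => k _.
  by rewrite br_row /B -mulmxA -AB0 mulmxA PD -mulmxA row_diag_mul scalerA !mxE.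
exists m, B, L; split=> // [x y|].
  by rewrite /B (eqmxMfull _ _) // row_full_unit.
apply/matrixP=> j i; rewrite !mxE.
have : br (row j B) (row i B) = 0.
  by apply: dab; apply/derB0; apply: submx_trans (row_sub _ _) (submxMl _ _).
move/eqP; rewrite brL scalemx_eq0 => /orP[/eqP|/eqP Bi0].
  by rewrite -row_mul !mxE.
have /(row_free_inj Bfree) : (delta_mx 0 i : 'rV_m) *m B = 0 *m B.
  by rewrite mul0mx -rowE.
by move/rowP/(_ i)/eqP; rewrite !mxE !eqxx oner_eq0.
Qed.

End LieBracket.

(** * Coordinates along a weight basis and the adapted inner products *)

(** A right inverse of [B] gives the required values on the rows; a multiple of a functional that
    vanishes on their span but not at [x] then corrects the value at [x]. *)
Lemma exists_coordinate (F : fieldType) n m (B : 'M[F]_(m, n)) (x : 'rV[F]_n)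
    (i : 'I_m) (a : F) :
  row_free B -> ~~ (x <= B)%MS ->
  exists2 f : 'cV[F]_n, B *m f = delta_mx i 0 & (x *m f) 0 0 = a.
Proof.
move=> /row_freeP[Phi BPhi]; rewrite submxE => /eqP/matrixP xB.
move: (cokermx B) (mulmx_coker B) xB => C BC xB.
have [j nzj] : exists j, (x *m C) 0 j != 0.
  apply: contrapT => /forallNP all0; apply: xB => k j.
  by have /negP := all0 j; rewrite negbK ord1 [RHS]mxE => /eqP.
pose c := (a - (x *m Phi) 0 i) / (x *m C) 0 j.
exists (col i Phi + c *: col j C); rewrite mulmxDr -scalemxAr !colE !mulmxA.
  by rewrite BPhi mul1mx BC mul0mx scaler0 addr0.
by rewrite -!colE [LHS]mxE [(col _ _) _ _]mxE [X in _ + X]mxE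
  [(col _ _) _ _]mxE divfK // subrKC.
Qed.

Section WeightBasis.
Variables (R : realType) (N : nat) (br : 'rV[R]_N -> 'rV[R]_N -> 'rV[R]_N).
Hypothesis brP : is_lie_bracket br.
Variables (m : nat) (B : 'M[R]_(m, N)) (L : 'M[R]_(N, m)).
Hypothesis brB : forall x y, (br x y <= B)%MS.
Hypothesis brL : forall x i, br x (row i B) = (x *m L) 0 i *: row i B.
Hypothesis BL0 : B *m L = 0.

Definition lam (x : 'rV[R]_N) (i : 'I_m) : R := (x *m L) 0 i.

Lemma lamDB x (c : 'rV_m) i : lam (x + c *m B) i = lam x i.
Proof. by rewrite /lam mulmxDl -mulmxA BL0 mulmx0 addr0. Qed.

Lemma lamBZ x a y i : lam (x - a *: y) i = lam x i - a * lam y i.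
Proof.
by rewrite /lam mulmxBl -scalemxAl [LHS]mxE [X in _ + X]mxE [X in - X]mxE.
Qed.

Lemma br_mulB x (c : 'rV_m) :
  br x (c *m B) = (\row_k (lam x k * c 0 k)) *m B.
Proof.
rewrite (mulmx_sum_row c) (br_sumr brP) mulmx_sum_row; apply: eq_bigr => k _.
by rewrite (brZr brP) brL scalerA mxE mulrC.
Qed.

Section Coordinates.
Variable Phi : 'M[R]_(N, m).
Hypothesis BPhi : B *m Phi = 1%:M.

(** Extends the coordinates along [B] to the whole algebra. The complement [p] is [ker Phi], so
    choosing [Phi] amounts to choosing [p]. *)
Definition phi (x : 'rV[R]_N) (i : 'I_m) : R := (x *m Phi) 0 i.

Lemma phiD x y i : phi (x + y) i = phi x i + phi y i.
Proof. by rewrite /phi mulmxDl mxE. Qed.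

Lemma phiZ a x i : phi (a *: x) i = a * phi x i.
Proof. by rewrite /phi -scalemxAl mxE. Qed.

Lemma phiN x i : phi (- x) i = - phi x i.
Proof. by rewrite /phi mulNmx mxE. Qed.

Lemma phi_mulB (c : 'rV_m) i : phi (c *m B) i = c 0 i.
Proof. by rewrite /phi -mulmxA BPhi mulmx1. Qed.

Lemma mul_PhiB (v : 'rV_N) : (v <= B)%MS -> v *m Phi *m B = v.
Proof. by case/submxP=> c ->; rewrite -(mulmxA c) BPhi mulmx1. Qed.

Lemma phi_br x v i : (v <= B)%MS -> phi (br x v) i = lam x i * phi v i.
Proof. by case/submxP=> c ->; rewrite br_mulB !phi_mulB mxE. Qed.

Lemma phi_jacobi x y z i :
  lam x i * phi (br y z) i + lam y i * phi (br z x) i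
    + lam z i * phi (br x y) i = 0.
Proof.
have [_ _ _ jac] := brP; rewrite -!phi_br // -!phiD jac.
by rewrite /phi mul0mx mxE.
Qed.

(* For [s = 0] the rows of [B] are orthonormal; as [s] tends to [1] their
   mutual angles tend to zero. They are always orthogonal to [ker Phi]. *)
Definition weight_ip (s : R) (x y : 'rV[R]_N) : R :=
  (1 - s) * (\sum_i phi x i * phi y i)
  + s * ((\sum_i phi x i) * (\sum_i phi y i))
  + \sum_k (x - x *m Phi *m B) 0 k * (y - y *m Phi *m B) 0 k.

Lemma weight_ip_inner s : 0 <= s < 1 -> is_inner_product (weight_ip s).
Proof.
move=> /andP[s0 s1]; split.
- move=> a x y z; rewrite /weight_ip.
  have -> : \sum_i phi (a *: x + y) i * phi z i =
      a * (\sum_i phi x i * phi z i) + \sum_i phi y i * phi z i.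
    by rewrite mulr_sumr -big_split /=; apply: eq_bigr => i _;
      rewrite phiD phiZ; ring.
  have -> : \sum_i phi (a *: x + y) i = a * (\sum_i phi x i) + \sum_i phi y i.
    by rewrite mulr_sumr -big_split /=; apply: eq_bigr => i _; rewrite phiD phiZ.
  have -> : a *: x + y - (a *: x + y) *m Phi *m B =
      a *: (x - x *m Phi *m B) + (y - y *m Phi *m B).
    by rewrite !mulmxDl -!scalemxAl scalerBr opprD addrACA.
  set u := x - _; set v := y - _; set w := z - _.
  have -> : \sum_k (a *: u + v) 0 k * w 0 k =
      a * (\sum_k u 0 k * w 0 k) + \sum_k v 0 k * w 0 k.
    by rewrite mulr_sumr -big_split /=; apply: eq_bigr => i _; rewrite !mxE; ring.
  ring.
- move=> x y; rewrite /weight_ip; congr (_ * _ + _ * _ + _).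
  + by apply: eq_bigr => i _; rewrite mulrC.
  + by rewrite mulrC.
  + by apply: eq_bigr => i _; rewrite mulrC.
- move=> x x0; rewrite /weight_ip.
  set p := \sum_i _; set q := (X in s * X); set r := \sum_k _.
  have p0 : 0 <= p by apply: sumr_ge0 => i _; rewrite -expr2 sqr_ge0.
  have q0 : 0 <= s * q by rewrite mulr_ge0 // /q -expr2 sqr_ge0.
  have r0 : 0 <= r by apply: sumr_ge0 => i _; rewrite -expr2 sqr_ge0.
  have s10 : 0 < 1 - s by rewrite subr_gt0.
  have p'0 : 0 <= (1 - s) * p by rewrite mulr_ge0 // ltW.
  rewrite lt_neqAle addr_ge0 ?addr_ge0 // andbT eq_sym; apply: contra x0.
  rewrite paddr_eq0 ?addr_ge0 // paddr_eq0 // mulf_eq0 (gt_eqF s10) /=.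
  case/andP=> /andP[/eqP pe _] /eqP re.
  have xPhi : x *m Phi = 0.
    apply/rowP=> i; rewrite [RHS]mxE; apply/eqP; rewrite -sqrf_eq0 expr2.
    by apply/eqP; apply: (psumr_eq0P _ pe) => // j _; rewrite -expr2 sqr_ge0.
  apply/eqP/rowP=> k; rewrite [RHS]mxE; apply/eqP; rewrite -sqrf_eq0 expr2.
  have rk := psumr_eq0P _ re; rewrite xPhi mul0mx subr0 in rk.
  by apply/eqP; apply: rk => // j _; rewrite -expr2 sqr_ge0.
Qed.

Lemma weight_ip_derived s x v : (v <= B)%MS ->
  weight_ip s x v = (1 - s) * (\sum_i phi x i * phi v i)
    + s * ((\sum_i phi x i) * (\sum_i phi v i)).
Proof.
move=> vB; rewrite /weight_ip [X in _ + X]big1 ?addr0 // => k _.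
by rewrite (mul_PhiB vB) subrr [(0 : 'rV_N) _ _]mxE mulr0.
Qed.

Lemma geodesic_ker s x : x *m Phi = 0 -> x != 0 ->
  geodesic_element (weight_ip s) br x.
Proof.
move=> xPhi x0; split=> // y; rewrite weight_ip_derived //.
have phi0 i : phi x i = 0 by rewrite /phi xPhi mxE.
rewrite big1 => [|i _]; last by rewrite phi0 mul0r.
by rewrite big1 => [|i _]; rewrite ?phi0 // mul0r !mulr0 addr0.
Qed.

Lemma geodesic_ker_annihilated s (h : 'cV_N) :
  (forall X, geodesic_element (weight_ip s) br X -> X *m h = 0) ->
  forall x : 'rV_N, x *m Phi = 0 -> x *m h = 0.
Proof.
move=> hP x xPhi; have [->|x0] := eqVneq x 0; first by rewrite mul0mx.
by apply: hP; apply: geodesic_ker.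
Qed.

(** Nonzero elements of [ker Phi] are geodesic already, so only the rows of [B] remain to be
    reached. *)
Lemma weight_geodesic_basis s :
  (forall h : 'cV_N,
     (forall X, geodesic_element (weight_ip s) br X -> X *m h = 0) ->
     forall i, row i B *m h = 0) ->
  has_geodesic_basis (weight_ip s) br.
Proof.
move=> hB; apply: basis_of_separating => h hP.
have Bh : B *m h = 0 by apply/row_matrixP=> i; rewrite row_mul hB ?row0.
suff xh x : (x : 'rV_N) *m h = 0.
  by apply/row_matrixP=> i; rewrite row0 rowE xh.
rewrite -(subrK (x *m Phi *m B) x) mulmxDl -[_ *m B *m h]mulmxA Bh mulmx0 addr0.
apply: (geodesic_ker_annihilated hP).
by rewrite mulmxBl -(mulmxA (x *m Phi)) BPhi mulmx1 subrr.
Qed.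

(** The inequality makes [d] nonzero, where the geodesic element [X] built for [i] is [d *: row i B]
    modulo [ker Phi]. *)
Lemma geodesic_basis_noncritical :
  (forall i, (forall x, lam x i = 0) \/
     exists x y, [/\ lam x i = 0, lam y i = 1 & phi x i != phi (br y x) i]) ->
  has_geodesic_basis (weight_ip 0) br.
Proof.
move=> noncrit; apply: weight_geodesic_basis => h hP i.
have [Bi0|Bi0] := eqVneq (row i B) 0; first by rewrite Bi0 mul0mx.
have phiBi j : phi (row i B) j = (j == i)%:R.
  by rewrite rowE phi_mulB mxE eqxx.
have [lam0|[x [y [lamx lamy nzd]]]] := noncrit i.
  (* A weight that vanishes identically makes [row i B] central. *)
  apply: hP; split=> // Y; rewrite (brC brP) brL [_ 0 i]lam0 scale0r oppr0.
  have phi0 j : phi 0 j = 0 by rewrite /phi mul0mx mxE.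
  rewrite weight_ip_derived ?sub0mx // big1 => [|j _]; last by rewrite phi0 mulr0.
  by rewrite [X in _ * (_ * X)]big1 ?mulr0 ?addr0.
pose d := phi x i - phi (br y x) i.
have nzd' : d != 0 by rewrite subr_eq0.
(* Adding [c *m B] leaves the weights of [x] unchanged. The entries off [i] clear the other
   coordinates; the entry at [i] cancels that of [br y x], because [lam y i = 1]. *)
pose c : 'rV_m := \row_j (if j == i then - phi (br y x) i else - phi x j).
pose X := x + c *m B.
have phiX j : phi X j = d * (j == i)%:R.
  rewrite phiD phi_mulB mxE /d; case: eqP => [->|_]; rewrite ?mulr1 //.
  by rewrite subrr mulr0.
have Xgeo : geodesic_element (weight_ip 0) br X.
  split.
    apply: contra nzd' => /eqP X0; have := phiX i.
    by rewrite X0 eqxx mulr1 => <-; rewrite /phi mul0mx mxE.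
  move=> Z; rewrite weight_ip_derived // subr0 mul1r mul0r addr0.
  suff brXZ : phi (br X Z) i = 0.
    rewrite big1 // => j _; rewrite phiX.
    by case: (eqVneq j i) => [->|_]; rewrite ?brXZ ?mulr0 ?mul0r.
  have yX : phi (br y X) i = 0.
    by rewrite (brDr brP) phiD br_mulB phi_mulB !mxE eqxx lamy mul1r subrr.
  (* Since [lam X i = 0] and [lam y i = 1], the vanishing for [br y X] passes to every [br Z X]. *)
  have := phi_jacobi X y Z i; rewrite (lamDB x) lamx lamy mul0r add0r mul1r.
  by rewrite (brC brP X y) (brC brP Z X) !phiN yX oppr0 mulr0 addr0 => /eqP;
     rewrite oppr_eq0 => /eqP.
have : (X - d *: row i B) *m h = 0.
  apply: (geodesic_ker_annihilated hP); apply/rowP=> j.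
  by rewrite [LHS]phiD phiN phiZ phiX phiBi subrr mxE.
rewrite mulmxBl (hP X Xgeo) sub0r -scalemxAl => /eqP.
by rewrite oppr_eq0 scalemx_eq0 (negPf nzd') => /eqP.
Qed.

(** With proportional weights, [Z] enters the inner product only through the factor [- z Z], which
    leaves one quadratic condition on [a] and [b]. *)
Lemma geodesic_pair s (mu z : _) i j (a b : R) : i != j ->
  (forall Z k, lam Z k = z Z * mu k) -> (a != 0) || (b != 0) ->
  a ^+ 2 * mu i + s * a * b * (mu i + mu j) + b ^+ 2 * mu j = 0 ->
  geodesic_element (weight_ip s) br (a *: row i B + b *: row j B).
Proof.
move=> ij lamE ab0 q0.
pose c : 'rV_m := a *: delta_mx 0 i + b *: delta_mx 0 j.
have -> : a *: row i B + b *: row j B = c *m B.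
  by rewrite mulmxDl -!scalemxAl -!rowE.
have cE k : c 0 k = a * (k == i)%:R + b * (k == j)%:R by rewrite !mxE !eqxx.
have sum2 (F : 'I_m -> R) : (forall k, k != i -> k != j -> F k = 0) ->
    \sum_k F k = F i + F j.
  move=> F0; rewrite (bigD1 i) //= (bigD1 j) 1?eq_sym //= big1 ?addr0 //.
  by move=> k /andP[ki kj]; apply: F0.
have ci : c 0 i = a by rewrite cE eqxx (negPf ij) mulr1 mulr0 addr0.
have cj : c 0 j = b by rewrite cE eqxx eq_sym (negPf ij) mulr1 mulr0 add0r.
have c0 k : k != i -> k != j -> c 0 k = 0.
  by move=> /negPf ki /negPf kj; rewrite cE ki kj !mulr0 addr0.
split.
  apply/eqP => cB0; have phic k : c 0 k = 0.
    by rewrite -(phi_mulB c) cB0 /phi mul0mx mxE.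
  by move: ab0; rewrite -ci -cj !phic eqxx.
move=> Z; rewrite weight_ip_derived // (brC brP) br_mulB.
have phiE k : phi (- ((\row_k (lam Z k * c 0 k)) *m B)) k =
    - (z Z * mu k * c 0 k).
  by rewrite phiN phi_mulB mxE lamE.
rewrite !sum2; try by move=> k ki kj;
  rewrite ?phi_mulB ?phiE c0 ?mulr0 ?oppr0 ?mul0r.
rewrite !phiE !phi_mulB ci cj.
by transitivity (- z Z *
    (a ^+ 2 * mu i + s * a * b * (mu i + mu j) + b ^+ 2 * mu j));
  [ring | rewrite q0 mulr0].
Qed.

End Coordinates.
End WeightBasis.

(** * Isotropic lines of binary forms and the choice of the angle *)

Lemma binary_form_isotropic_pair (R : rcfType) (s p q : R) : s != 0 ->
  4 * p * q < s ^+ 2 * (p + q) ^+ 2 ->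
  exists a b a' b' : R,
  [/\ a ^+ 2 * p + s * a * b * (p + q) + b ^+ 2 * q = 0,
      a' ^+ 2 * p + s * a' * b' * (p + q) + b' ^+ 2 * q = 0
    & a * b' - a' * b != 0].
Proof.
move=> s0 disc; have [->|p0] := eqVneq p 0.
  (* Here the form factors as [q * b * (s * a + b)]. *)
  exists 1, 0, (- s^-1), 1; split; [by ring | by field | ].
  by rewrite !mulr1 mulr0 subr0 oner_neq0.
pose D := s ^+ 2 * (p + q) ^+ 2 - 4 * p * q.
have D0 : 0 < D by rewrite subr_gt0.
have sqD : Num.sqrt D ^+ 2 = D by rewrite sqr_sqrtr // ltW.
(* The quadratic formula with [b = 1], for either square root [e] of [D]. *)
have root (e : R) : e ^+ 2 = D ->
    ((e - s * (p + q)) / (2 * p)) ^+ 2 * p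
      + s * ((e - s * (p + q)) / (2 * p)) * 1 * (p + q) + 1 ^+ 2 * q = 0.
  move=> eD.
  transitivity ((e ^+ 2 - D) / (4 * p)); last by rewrite eD subrr mul0r.
  by rewrite /D; field.
exists ((Num.sqrt D - s * (p + q)) / (2 * p)), 1,
       ((- Num.sqrt D - s * (p + q)) / (2 * p)), 1.
split; [exact: root | by apply: root; rewrite sqrrN | ].
rewrite (_ : _ - _ = Num.sqrt D / p); last by field.
by rewrite mulf_neq0 ?invr_eq0 // gt_eqF // sqrtr_gt0.
Qed.

(** One [s] must serve all pairs. As [M] bounds every ratio [r i j], at [s = 1 - M^-1 / 4] the
    discriminant is at least half of its limit [(mu i - mu j) ^+ 2]. *)
Lemma exists_uniform_cosine (R : realFieldType) (I : finType) (mu : I -> R) :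
  exists2 s : R, 0 < s < 1 & forall i j, mu i != mu j ->
    4 * mu i * mu j < s ^+ 2 * (mu i + mu j) ^+ 2.
Proof.
(* For [mu i = mu j] the quotient is zero by convention. The summand [1] in [M] keeps [M^-1] at most
   [1], hence [s] positive. *)
pose r i j := (mu i + mu j) ^+ 2 / (mu i - mu j) ^+ 2.
pose M := 1 + \sum_i \sum_j r i j.
have r0 i j : 0 <= r i j by rewrite divr_ge0 ?sqr_ge0.
have S0 : 0 <= \sum_i \sum_j r i j.
  by apply: sumr_ge0 => i _; apply: sumr_ge0 => j _.
have M1 : 1 <= M by rewrite lerDl.
have M0 : 0 < M by lra.
have e0 : 0 < M^-1 by rewrite invr_gt0.
have e1 : M^-1 <= 1 by rewrite invf_le1.
exists (1 - M^-1 / 4) => [|i j nij]; first by apply/andP; split; lra.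
have d0 : 0 < (mu i - mu j) ^+ 2 by rewrite exprn_even_gt0 //= subr_eq0.
have rM : r i j <= M.
  apply: (@le_trans _ _ (\sum_i \sum_j r i j)); last by rewrite lerDr.
  rewrite (bigD1 i) //= (bigD1 j) //= -addrA lerDl addr_ge0 //.
    by apply: sumr_ge0.
  by apply: sumr_ge0 => k _; apply: sumr_ge0.
have : M^-1 * (mu i + mu j) ^+ 2 <= (mu i - mu j) ^+ 2.
  by rewrite mulrC ler_pdivrMr // mulrC -ler_pdivrMr.
have : 0 <= (M^-1) ^+ 2 * (mu i + mu j) ^+ 2 by rewrite -exprMn sqr_ge0.
have -> : (1 - M^-1 / 4) ^+ 2 * (mu i + mu j) ^+ 2 =
   (mu i + mu j) ^+ 2 - (M^-1 * (mu i + mu j) ^+ 2) / 2 +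
   (M^-1 ^+ 2 * (mu i + mu j) ^+ 2) / 16 by field; rewrite gt_eqF.
have -> : (mu i + mu j) ^+ 2 = (mu i - mu j) ^+ 2 + 4 * mu i * mu j by ring.
lra.
Qed.

Lemma A_bracket_row_mx (R : realType) n (a b : R) (p q : 'rV[R]_n) :
  A_bracket (row_mx a%:M p) (row_mx b%:M q) = row_mx (0 : 'rV_1) (a *: q - b *: p).
Proof.
have E (c : R) (r : 'rV[R]_n) : row_mx c%:M r 0 ord0 = c.
  transitivity ((c%:M : 'M_1) 0 0); last by rewrite mxE.
  rewrite -(@row_mxEl R 1 1 n c%:M r 0 0).
  by congr (fun_of_matrix _ _ _); apply: val_inj.
have {E} := (E a p, E b q).
have Er (c : R) (r : 'rV[R]_n) l : row_mx (c%:M : 'M_1) r 0 (rshift 1 l) = r 0 l.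
  by rewrite row_mxEr.
have {Er} := (Er a p, Er b q).
move: (row_mx a%:M p) (row_mx b%:M q) => u v [ur vr] [u0 v0].
rewrite /A_bracket u0 v0; apply/rowP=> k.
case: (@split_ordP 1 n k) => l ->.
  rewrite ord1 [RHS](@row_mxEl R 1 1 n).
  have -> : lshift n (0 : 'I_1) = ord0 :> 'I_n.+1 by apply: val_inj.
  by rewrite /e0 !mxE u0 v0 !eqxx; ring.
by rewrite [RHS](@row_mxEr R 1 1 n) /e0 !mxE ur vr andbF; ring.
Qed.

(** * The three cases: wide kernels, distinct eigenvalues, and the algebras [A_n] *)

Section Construction.
Variables (R : realType) (N : nat) (br : 'rV[R]_N -> 'rV[R]_N -> 'rV[R]_N).
Hypothesis brP : is_lie_bracket br.
Variables (m : nat) (B : 'M[R]_(m, N)) (L : 'M[R]_(N, m)).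
Hypothesis Bfree : row_free B.
Hypothesis brB : forall x y, (br x y <= B)%MS.
Hypothesis brL : forall x i, br x (row i B) = (x *m L) 0 i *: row i B.
Hypothesis BL0 : B *m L = 0.

Local Notation lam := (lam L).

(** The complement is tilted one column of [Phi] at a time: [f i] is prescribed on the span of [B]
    but free at a vector outside it. *)
Lemma geodesic_basis_wide :
  (forall i, (forall x, lam x i = 0) \/
     exists2 x, lam x i = 0 & ~~ (x <= B)%MS) ->
  exists ip, is_inner_product ip /\ has_geodesic_basis ip br.
Proof.
move=> wide; have [Phi0 BPhi0] := row_freeP Bfree.
have /choice[f fP] i : exists f : 'cV[R]_N, B *m f = delta_mx i 0 /\
    ((forall x, lam x i = 0) \/ exists x y,
       [/\ lam x i = 0, lam y i = 1 & (x *m f) 0 0 != (br y x *m f) 0 0]).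
  have [lam0|[x lamx xB]] := wide i.
    exists (col i Phi0); split; last by left.
    by rewrite colE mulmxA BPhi0 mul1mx.
  have [lam0|/existsNP[z /eqP lamz]] := pselect (forall x, lam x i = 0).
    exists (col i Phi0); split; last by left.
    by rewrite colE mulmxA BPhi0 mul1mx.
  pose y := (lam z i)^-1 *: z.
  have lamy : lam y i = 1 by rewrite /lam /y -scalemxAl mxE mulVf.
  have [c brc] := submxP (brB y x).
  (* The [i]-th coordinate [c 0 i] of [br y x] is the same for every admissible [f]; the value at
     [x] is made to differ from it by one. *)
  have [f Bf xf] := exists_coordinate i (c 0 i + 1) Bfree xB.
  exists f; split=> //; right; exists x, y; split=> //.
  rewrite xf brc -mulmxA Bf -colE mxE.
  by rewrite -subr_eq0 addrAC subrr add0r oner_neq0.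
pose Phi : 'M_(N, m) := \matrix_(k, i) f i k 0.
have colPhi i : col i Phi = f i by apply/colP=> k; rewrite !mxE.
have BPhi : B *m Phi = 1%:M.
  apply/matrixP=> i j; have [/matrixP/(_ i 0) + _] := fP j.
  by rewrite -colPhi colE mulmxA -colE !mxE eqxx andbT => ->.
exists (weight_ip B Phi 0); split;
  first by apply: weight_ip_inner; rewrite lexx ltr01.
apply: (geodesic_basis_noncritical brP brB brL BL0 BPhi) => i.
have [_ [lam0|[x [y [lamx lamy nz]]]]] := fP i; first by left.
right; exists x, y; split=> //; move: nz.
by rewrite -colPhi colE !mulmxA -!colE ![(col _ _) _ _]mxE.
Qed.

Lemma geodesic_basis_narrow (mu : 'I_m -> R) (z : 'rV[R]_N -> R) i0 j0 :
  (forall Z k, lam Z k = z Z * mu k) -> mu i0 != mu j0 ->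
  exists ip, is_inner_product ip /\ has_geodesic_basis ip br.
Proof.
move=> lamE nij0; have [Phi BPhi] := row_freeP Bfree.
have [s /andP[s0 s1] disc] := exists_uniform_cosine mu.
exists (weight_ip B Phi s); split;
  first by apply: weight_ip_inner; rewrite (ltW s0).
apply: (weight_geodesic_basis brB BPhi) => h hP i.
(* Every index has a partner, since [mu i] cannot equal both [mu i0] and [mu j0]. *)
have [j nij] : exists j, mu i != mu j.
  have [ei|ni] := eqVneq (mu i) (mu i0); last by exists i0.
  by exists j0; rewrite ei.
have ij : i != j by apply: contra nij => /eqP->.
have [a [b [a' [b' [q1 q2 det]]]]] :=
  binary_form_isotropic_pair (lt0r_neq0 s0) (disc i j nij).
have hpair a1 b1 : (a1 != 0) || (b1 != 0) ->
    a1 ^+ 2 * mu i + s * a1 * b1 * (mu i + mu j) + b1 ^+ 2 * mu j = 0 ->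
    a1 *: (row i B *m h) + b1 *: (row j B *m h) = 0.
  move=> nz q; rewrite 2!scalemxAl -mulmxDl; apply: hP.
  exact: (geodesic_pair brP brB brL BPhi ij lamE).
have h1 : a *: (row i B *m h) + b *: (row j B *m h) = 0.
  apply: hpair => //; rewrite -negb_and; apply: contra det => /andP[/eqP-> /eqP->].
  by rewrite mul0r mulr0 subrr.
have h2 : a' *: (row i B *m h) + b' *: (row j B *m h) = 0.
  apply: hpair => //; rewrite -negb_and; apply: contra det => /andP[/eqP-> /eqP->].
  by rewrite mul0r mulr0 subrr.
(* Cramer's rule applied to [h1] and [h2]. *)
have : (a * b' - a' * b) *: (row i B *m h) = 0.
  transitivity (b' *: (a *: (row i B *m h) + b *: (row j B *m h))
     - b *: (a' *: (row i B *m h) + b' *: (row j B *m h))); last first.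
    by rewrite h1 h2 !scaler0 subrr.
  by apply/matrixP=> k l; rewrite !mxE; ring.
by move/eqP; rewrite scalemx_eq0 (negPf det) => /eqP.
Qed.

(** The algebra is the line of [y] plus the span of [B], on which [y] acts as the identity. With
    [Phi] chosen to kill [y], the map [F] sends [y] to the first basis vector and the rows of [B] to
    the others. *)
Lemma iso_A_bracket (y : 'rV[R]_N) (i : 'I_m) :
  lam y i = 1 -> (forall x, lam x i = 0 -> (x <= B)%MS) ->
  (forall x k, lam x k = lam x i) -> lie_isomorphic br (@A_bracket R m).
Proof.
move=> lamy kerB lamE; have [Phi0 BPhi0] := row_freeP Bfree.
have yB : ~~ (y <= B)%MS.
  apply/negP=> /submxP[c yc]; move/eqP: lamy.
  by rewrite yc -[c *m B]add0r (lamDB BL0) /lam mul0mx mxE eq_sym oner_eq0.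
have /choice[f fP] k : exists f : 'cV[R]_N, B *m f = delta_mx k 0 /\
    (y *m f) 0 0 = 0.
  by have [f Bf yf] := exists_coordinate k 0 Bfree yB; exists f.
pose Phi : 'M_(N, m) := \matrix_(l, k) f k l 0.
have colPhi k : col k Phi = f k by apply/colP=> l; rewrite !mxE.
have BPhi : B *m Phi = 1%:M.
  apply/matrixP=> k j; have [/matrixP/(_ k 0) + _] := fP j.
  by rewrite -colPhi colE mulmxA -colE !mxE eqxx andbT => ->.
have yPhi : y *m Phi = 0.
  apply/rowP=> k; have [_] := fP k.
  by rewrite -colPhi colE mulmxA -colE [(col _ _) _ _]mxE => ->; rewrite mxE.
pose F : 'M_(N, 1 + m) := row_mx (col i L) Phi.
have BLi : B *m col i L = 0 by rewrite colE mulmxA BL0 mul0mx.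
have yLi : y *m col i L = 1%:M.
  by apply/matrixP=> a b; rewrite !ord1 colE mulmxA -colE [LHS]mxE [LHS]lamy mxE.
have decomp x : x = lam x i *: y + (x *m Phi) *m B.
  have xy : (x - lam x i *: y <= B)%MS.
    by apply: kerB; rewrite lamBZ lamy mulr1 subrr.
  have := mul_PhiB BPhi xy; rewrite mulmxBl -scalemxAl yPhi scaler0 subr0 => ->.
  by rewrite subrKC.
have xF x : x *m F = row_mx (lam x i)%:M (x *m Phi).
  rewrite mul_mx_row; congr row_mx.
  by apply/matrixP=> a b; rewrite !ord1 colE mulmxA -colE [LHS]mxE [RHS]mxE.
have Ffree : row_free F.
  apply: inj_row_free => x; rewrite xF -row_mx0 => /eq_row_mx[l0 p0].
  rewrite (decomp x) p0 mul0mx addr0.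
  by move/matrixP/(_ 0 0): l0; rewrite mxE eqxx mulr1n => ->; rewrite mxE scale0r.
have Ffull : row_full F.
  apply/row_fullP; exists (col_mx y B).
  by rewrite mul_col_row yLi yPhi BLi BPhi -scalar_mx_block.
exists F; split=> // u v.
change (br u v *m F = A_bracket (u *m F) (v *m F)).
rewrite [u *m F]xF [v *m F]xF A_bracket_row_mx.
have brBy x c : br x (c *m B) = lam x i *: (c *m B).
  rewrite (br_mulB brP brL) scalemxAl; congr (_ *m B).
  by apply/rowP=> k; rewrite !mxE lamE.
have [_ _ alt _] := brP.
have bry x : br x y = - (x *m Phi *m B).
  by rewrite (brC brP) {1}(decomp x) (brDr brP) (brZr brP) alt scaler0
    add0r brBy lamy scale1r.
have -> : br u v = (lam u i *: (v *m Phi) - lam v i *: (u *m Phi)) *m B.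
  rewrite {1}(decomp v) (brDr brP) (brZr brP) bry brBy scalerN addrC.
  by rewrite mulmxBl !scalemxAl.
by rewrite mul_mx_row -!mulmxA BLi BPhi mulmx0 mulmx1.
Qed.

End Construction.

Theorem theorem1p2 (R : realType) (N : nat)
  (br : 'rV[R]_N -> 'rV[R]_N -> 'rV[R]_N) :
  is_lie_bracket br ->
  derived_abelian br ->
  (forall Y, ad_restr_real_semisimple br Y) ->
  (exists ip : 'rV[R]_N -> 'rV[R]_N -> R,
      is_inner_product ip /\ has_geodesic_basis ip br)
  \/ (exists n : nat, (1 <= n)%N /\ lie_isomorphic br (@A_bracket R n)).
Proof.
move=> brP dab ssimple.
have [m [B [L [Bfree brB brL BL0]]]] := weight_basis brP dab ssimple.
(* Otherwise some nonzero weight has its whole kernel inside the span of [B]. *)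
have [wide|/existsNP[i /not_orP[/existsNP[z /eqP lamz] narrow]]] :=
  pselect (forall i, (forall x, lam L x i = 0) \/
     exists2 x, lam L x i = 0 & ~~ (x <= B)%MS).
  by left; apply: (geodesic_basis_wide brP Bfree brB brL BL0 wide).
pose y := (lam L z i)^-1 *: z.
have lamy : lam L y i = 1 by rewrite /lam /y -scalemxAl mxE mulVf.
have kerB x : lam L x i = 0 -> (x <= B)%MS.
  by move=> lamx; apply: contrapT => /negP xB; apply: narrow; exists x.
(* The vector [x - lam L x i *: y] is killed by weight [i], so it lies in the span of [B], where all
   weights vanish. *)
have lamE x k : lam L x k = lam L x i * lam L y k.
  have /submxP[c xc] : (x - lam L x i *: y <= B)%MS.
    by apply: kerB; rewrite lamBZ lamy mulr1 subrr.
  apply/eqP; rewrite -subr_eq0 -lamBZ xc -[c *m B]add0r (lamDB BL0).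
  by rewrite /lam mul0mx mxE.
have [eqlam|/existsNP[k /eqP nek]] := pselect (forall k, lam L y k = lam L y i).
  right; exists m; split; first exact: leq_ltn_trans (ltn_ord i).
  apply: (iso_A_bracket brP Bfree brL BL0 lamy kerB) => x k.
  by rewrite lamE eqlam lamy mulr1.
by left; apply: (geodesic_basis_narrow brP Bfree brB brL lamE nek).
Qed.
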